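(* Let $n>2$. For any positive integer $M$, there exists an irreducible (complex, finite-dimensional) representation of the braid group $\mathbb{B}_n$ of dimension greater than $M$.
   Context: The braid group $\mathbb{B}_n$ is presented by generators $\tau_1,\dots,\tau_{n-1}$ with relations $\tau_k\tau_j=\tau_j\tau_k$ if $|k-j|>1$ and $\tau_k\tau_{k+1}\tau_k=\tau_{k+1}\tau_k\tau_{k+1}$ for $1\le k\le n-2$. *)

(* Defs.v *)
From HB Require Import structures.
From mathcomp Require Import all_boot all_order all_algebra.
From mathcomp Require Import boolp reals.
From mathcomp Require Import complex.

Set Implicit Arguments.
Unset Strict Implicit.
Unset Printing Implicit Defensive.

Import GRing.Theory.

Section Presentation.

Variable I : choiceType.

(* The letter (i, true) stands for the generator i, and (i, false) for its
   inverse. *)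
Definition word : choiceType := seq (I * bool)%type.

Definition gen (i : I) : I * bool := (i, true).

Definition word_inv (u : word) : word := rev [seq (x.1, ~~ x.2) | x <- u].

Variable rel : word -> word -> Prop.

(* The congruence on words generated by the free cancellations and by the
   relations u = v for rel u v. *)
Inductive pres_eq : word -> word -> Prop :=
| PresRefl u : pres_eq u u
| PresSym u v : pres_eq u v -> pres_eq v u
| PresTrans u v w : pres_eq u v -> pres_eq v w -> pres_eq u w
| PresCat u u' v v' :
    pres_eq u u' -> pres_eq v v' -> pres_eq (u ++ v) (u' ++ v')
| PresCancel i b : pres_eq [:: (i, b); (i, ~~ b)] [::]
| PresRel u v : rel u v -> pres_eq u v.

Definition pres_eqb (u v : word) : bool := `[< pres_eq u v >].

Fact pres_eqb_refl : reflexive pres_eqb.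
Proof. by move=> u; apply/asboolP; exact: PresRefl. Qed.

Fact pres_eqb_sym : symmetric pres_eqb.
Proof. by move=> u v; apply/asboolP/asboolP => /PresSym. Qed.

Fact pres_eqb_trans : transitive pres_eqb.
Proof.
by move=> v u w /asboolP uv /asboolP vw; apply/asboolP/(PresTrans uv vw).
Qed.

Canonical pres_equiv :=
  EquivRel pres_eqb pres_eqb_refl pres_eqb_sym pres_eqb_trans.

Definition presented := {eq_quot pres_equiv}%qT.

HB.instance Definition _ := Choice.on presented.
HB.instance Definition _ := Quotient.on presented.
HB.instance Definition _ := EqQuotient.on presented.

Definition pres_class (u : word) : presented := \pi_presented%qT u.

Lemma pres_classP u v : pres_class u = pres_class v <-> pres_eq u v.
Proof.
split=> [/eqP|uv]; first by rewrite /pres_class eqmodE => /asboolP.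
by apply/eqP; rewrite /pres_class eqmodE; apply/asboolP.
Qed.

Lemma pres_class_repr (x : presented) : pres_class (repr x) = x.
Proof. exact: reprK. Qed.

Definition pres_one : presented := pres_class [::].
Definition pres_mul (x y : presented) : presented :=
  pres_class (repr x ++ repr y).
Definition pres_inv (x : presented) : presented :=
  pres_class (word_inv (repr x)).

Fact pres_mulE u v :
  pres_mul (pres_class u) (pres_class v) = pres_class (u ++ v).
Proof. by apply/pres_classP/PresCat; apply/pres_classP/pres_class_repr. Qed.

Fact word_invK : involutive word_inv.
Proof.
move=> u; rewrite /word_inv map_rev revK -map_comp -[RHS]map_id.
by apply: eq_map => -[i b] /=; rewrite negbK.
Qed.

Fact word_mulV u : pres_eq (u ++ word_inv u) [::].
Proof.
elim: u => [|[i b] u IHu] /=; first exact: PresRefl.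
rewrite /word_inv /= rev_cons -/(word_inv u) -cats1 catA.
apply: (PresTrans _ (PresCancel i b)).
apply: (@PresCat [:: (i, b)] [:: (i, b)] _ [:: (i, ~~ b)]).
  exact: PresRefl.
by apply: (@PresCat _ [::]); [exact: IHu | exact: PresRefl].
Qed.

Fact pres_mulA : associative pres_mul.
Proof.
move=> x y z; rewrite -(pres_class_repr x) -(pres_class_repr y).
by rewrite -(pres_class_repr z) !pres_mulE catA.
Qed.

Fact pres_mul1g : left_id pres_one pres_mul.
Proof. by move=> x; rewrite -(pres_class_repr x) pres_mulE. Qed.

Fact pres_mulg1 : right_id pres_one pres_mul.
Proof. by move=> x; rewrite -(pres_class_repr x) pres_mulE cats0. Qed.

Fact pres_mulgV : right_inverse pres_one pres_inv pres_mul.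
Proof.
move=> x; rewrite -{1}(pres_class_repr x) pres_mulE.
exact/pres_classP/word_mulV.
Qed.

Fact pres_mulVg : left_inverse pres_one pres_inv pres_mul.
Proof.
move=> x; rewrite -{2}(pres_class_repr x) pres_mulE.
by apply/pres_classP; rewrite -{2}(word_invK (repr x)); exact: word_mulV.
Qed.

HB.instance Definition _ := isGroup.Build presented
  pres_mulA pres_mul1g pres_mulg1 pres_mulVg pres_mulgV.

Lemma pres_class1 : pres_class [::] = 1%g.
Proof. by []. Qed.

Lemma pres_classM u v : pres_class (u ++ v) = (pres_class u * pres_class v)%g.
Proof. by rewrite -pres_mulE. Qed.

Lemma pres_classV u : pres_class (word_inv u) = (pres_class u)^-1%g.
Proof.
apply/esym/(mulgI (pres_class u)); rewrite mulgV -pres_classM.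
exact/esym/pres_classP/word_mulV.
Qed.

End Presentation.

(* The ordinal k : 'I_n.-1 indexes the generator tau_(k + 1). *)
Inductive braid_rel (n : nat) : word 'I_n.-1 -> word 'I_n.-1 -> Prop :=
| BraidFar (k j : 'I_n.-1) : (1 < `|k - j|)%N ->
    braid_rel [:: gen k; gen j] [:: gen j; gen k]
| BraidAdj (k j : 'I_n.-1) : j = k.+1 :> nat ->
    braid_rel [:: gen k; gen j; gen k] [:: gen j; gen k; gen j].

Definition braid_group (n : nat) : groupType := presented (@braid_rel n).

Record representation (K : fieldType) (G : groupType) (V : vectType K) := {
  rep_fun :> G -> 'End(V);
  rep1 : rep_fun 1%g = \1%VF;
  repM : forall x y : G, rep_fun (x * y)%g = (rep_fun x \o rep_fun y)%VF
}.

Definition irreducible_rep (K : fieldType) (G : groupType) (V : vectType K)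
    (rho : representation G V) : Prop :=
  (fullv : {vspace V}) <> 0%VS /\
  forall U : {vspace V}, (forall g : G, (rho g @: U <= U)%VS) ->
    U = 0%VS \/ U = fullv.

(* Main.v *)
From HB Require Import structures.
Require Import Defs.
From mathcomp Require Import all_boot all_order all_algebra.
From mathcomp Require Import perm cyclic separable cyclotomic.
From mathcomp Require Import boolp reals complex ring.

(** The idea is Frobenius' lower bound for the degrees of SL_2 over Z/N,
    carried over to the braid group.  Suppose that a representation sigma has
    elements t and y with sigma(t y) = sigma(y t^4).  Then sigma(y) carries
    eigenvectors of sigma(t) for a to eigenvectors for a^4, so the eigenvalues
    of sigma(t) are stable under a |-> a^4 (eigen_orbit).  If one of them is a
    primitive root of unity of order N = 4^(M+1) - 1, the powers w^(4^k),
    k <= M, are M + 1 distinct eigenvalues, and the dimension exceeds M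
    (eigenvalues_le_dim).

    It is enough to find one such representation, irreducible or not: both the
    relation and the eigenvalue are inherited by some irreducible subquotient,
    since an eigenvector either lies in an invariant subspace or survives in
    the quotient by it (irreducible_subquotient_eigen).

    The representation is a permutation representation.  Let the generators
    act on the finite set (Z/N)^(n-1) by the transvections of the alternating
    form of the path with n - 1 vertices; up to duality this is the reduced
    Burau representation at -1, taken modulo N.  Two adjacent transvections generate a copy of
    SL_2(Z/N), in which diag(2, 1/2) conjugates the elementary unipotent
    matrix to its fourth power (transv_conj4, conj_pow4).  On the functions on
    (Z/N)^(n-1), an additive character of Z/N supported on a hyperplane is an
    eigenvector of the first generator with eigenvalue w
    (transv_character_eigen). *)

Set Implicit Arguments.
Unset Strict Implicit.
Unset Printing Implicit Defensive.

Import GRing.Theory Num.Theory passmx.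
Local Open Scope ring_scope.

(** * Homomorphisms out of a presented group *)

Section PresentedHom.
Variables (I : choiceType) (rel : word I -> word I -> Prop) (H : groupType).
Variable phi : I -> H.

Definition letter_val (x : I * bool) : H :=
  if x.2 then phi x.1 else (phi x.1)^-1%g.

Definition word_val (u : word I) : H := (\prod_(x <- u) letter_val x)%g.

Hypothesis phi_rel : forall u v, rel u v -> word_val u = word_val v.

Lemma word_val_pres_eq u v : pres_eq rel u v -> word_val u = word_val v.
Proof.
elim=> {u v} // [u v w _ -> _ -> //|u u' v v' _ Eu _ Ev|i b].
  by rewrite /word_val !big_cat /= -!/(word_val _) Eu Ev.
by rewrite /word_val !big_cons big_nil mulg1 /letter_val /=; case: b => /=;
  rewrite (mulgV, mulVg).
Qed.

Definition pres_lift (x : presented rel) : H := word_val (repr x).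

Lemma pres_lift_class u : pres_lift (pres_class rel u) = word_val u.
Proof. exact/word_val_pres_eq/pres_classP/pres_class_repr. Qed.

Lemma pres_lift_gen i : pres_lift (pres_class rel [:: gen i]) = phi i.
Proof. by rewrite pres_lift_class /word_val big_seq1. Qed.

Lemma pres_lift1 : pres_lift 1%g = 1%g.
Proof. by rewrite -(pres_class1 rel) pres_lift_class /word_val big_nil. Qed.

Lemma pres_liftM x y : pres_lift (x * y)%g = (pres_lift x * pres_lift y)%g.
Proof.
rewrite -(pres_class_repr x) -(pres_class_repr y) -pres_classM.
by rewrite !pres_lift_class /word_val big_cat.
Qed.

End PresentedHom.

(** * Permutation representations on functions *)

Section PermRep.
Variables (K : fieldType) (X : finType).

(** Products of permutations apply the left factor first, so precomposition
    without an inverse is already multiplicative. *)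
Definition precomp (s : {perm X}) (f : {ffun X -> K^o}) : {ffun X -> K^o} :=
  [ffun x => f (s x)].

Lemma precomp_is_linear s : linear (precomp s).
Proof. by move=> k f g; apply/ffunP=> x; rewrite !ffunE. Qed.

HB.instance Definition _ s :=
  GRing.isSemilinear.Build K _ _ _ (precomp s)
    (GRing.semilinear_linear (precomp_is_linear s)).

Variables (G : groupType) (psi : G -> {perm X}).
Hypothesis psi1 : psi 1%g = 1%g.
Hypothesis psiM : forall x y, psi (x * y)%g = (psi x * psi y)%g.

Lemma perm_rep1 : linfun (precomp (psi 1%g)) = \1%VF.
Proof.
apply/lfunP=> f; rewrite lfunE id_lfunE psi1.
by apply/ffunP=> x; rewrite ffunE perm1.
Qed.

Lemma perm_repM x y : linfun (precomp (psi (x * y)%g)) =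
  (linfun (precomp (psi x)) \o linfun (precomp (psi y)))%VF.
Proof.
apply/lfunP=> f; rewrite comp_lfunE !lfunE psiM.
by apply/ffunP=> z; rewrite /= !ffunE permM.
Qed.

Definition perm_rep : representation G {ffun X -> K^o} :=
  Build_representation perm_rep1 perm_repM.

End PermRep.

(** * Roots of unity and eigenvalues *)

(** In an algebraically closed field X^n - 1 splits, and it is separable when n
    is invertible; a set of n distinct n-th roots of unity contains a primitive
    one because finite multiplicative groups of a field are cyclic. *)
Lemma prim_root_exists (F : closedFieldType) n :
  n%:R != 0 :> F -> exists z : F, n.-primitive_root z.
Proof.
move=> nF; have n_gt0: (0 < n)%N by case: n nF => //; rewrite eqxx.
have [r Dp] := closed_field_poly_normal ('X^n - 1 : {poly F}).
rewrite (monicP _) ?monicXnsubC // scale1r in Dp.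
have rn1: all n.-unity_root r by apply/allP=> z; rewrite -root_prod_XsubC -Dp.
have sz_r: (n <= size r)%N.
  by rewrite -ltnS -(size_prod_XsubC r id) -Dp size_XnsubC.
have Ur: uniq r.
  by rewrite -separable_prod_XsubC -Dp separable_Xn_sub_1.
by have /hasP[z _] := has_prim_root n_gt0 rn1 Ur sz_r; exists z.
Qed.

(** Eigenvalues are roots of the characteristic polynomial. *)
Lemma eigenvalues_le_dim (K : fieldType) (V : vectType K) (f : 'End(V))
    (s : seq K) :
  uniq s -> (forall a, a \in s -> exists2 v : V, v != 0 & f v = a *: v) ->
  (size s <= \dim {:V})%N.
Proof.
move=> Us eigs; set e := vbasis {:V}.
pose A := mxof e e f.
rewrite -ltnS -(size_char_poly A); apply: max_poly_roots => //.
  exact/monic_neq0/char_poly_monic.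
apply/allP=> a /eigs[v v0 fv]; rewrite -eigenvalue_root_char.
apply/eigenvalueP; exists (rVof e v).
  by rewrite -rVof_app ?vbasisP // fv linearZ.
by rewrite rVof_eq0 ?vbasisP.
Qed.

(** * Subrepresentations, quotients and irreducible subquotients *)

Section Compression.
Variables (K : fieldType) (G : groupType) (V W : vectType K).
Variables (rho : representation G V) (s : 'Hom(W, V)) (p : 'Hom(V, W)).
Hypothesis sK : cancel s p.

(** This covers the two cases of use: the image of s is an invariant subspace,
    or the kernel of p is one. *)
Hypothesis compat : forall g h w,
  p (rho g (s (p (rho h (s w))))) = p (rho g (rho h (s w))).

Definition compress g : 'End(W) := (p \o rho g \o s)%VF.

Lemma compressE g w : compress g w = p (rho g (s w)).
Proof. by rewrite !comp_lfunE. Qed.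

Lemma compress1 : compress 1%g = \1%VF.
Proof. by apply/lfunP=> w; rewrite compressE rep1 !id_lfunE sK. Qed.

Lemma compressM g h : compress (g * h)%g = (compress g \o compress h)%VF.
Proof.
by apply/lfunP=> w; rewrite comp_lfunE !compressE compat repM comp_lfunE.
Qed.

Definition compress_rep : representation G W :=
  Build_representation compress1 compressM.

End Compression.

Section Stable.
Variables (K : fieldType) (G : groupType) (V : vectType K).
Variables (rho : representation G V) (U : {vspace V}).
Hypothesis Ust : forall g, (rho g @: U <= U)%VS.

Lemma stable_mem g u : u \in U -> rho g u \in U.
Proof. by move=> uU; apply: (subvP (Ust g)); apply: memv_img. Qed.

Let incl (W : {vspace V}) : 'Hom(subvs_of W, V) := linfun vsval.
Let proj_on (W : {vspace V}) : 'Hom(V, subvs_of W) := linfun (vsproj W).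

Lemma sub_incl_projK : cancel (incl U) (proj_on U).
Proof. by move=> w; rewrite !lfunE /= vsvalK. Qed.

Lemma sub_compat g h w :
  proj_on U (rho g (incl U (proj_on U (rho h (incl U w))))) =
  proj_on U (rho g (rho h (incl U w))).
Proof.
by congr (proj_on U (rho g _)); rewrite !lfunE /= vsprojK // stable_mem ?subvsP.
Qed.

Definition subrep := compress_rep sub_incl_projK sub_compat.

Lemma subrep_eigen t a v : v \in U -> v != 0 -> rho t v = a *: v ->
  exists2 w, w != 0 & subrep t w = a *: w.
Proof.
move=> vU v0 tv; exists (vsproj U v).
  by apply: contraNneq v0 => /(congr1 vsval); rewrite vsprojK // linear0 => ->.
by rewrite compressE !lfunE /= vsprojK // tv linearZ.
Qed.

(** The quotient by U is realised on a complement of U; the projection onto it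
    has to have kernel U, hence 1 - projv U rather than the projection that
    comes with the subspace U^C, whose kernel need not be U. *)
Let quo : 'Hom(V, subvs_of U^C) := (proj_on U^C \o (\1 - projv U))%VF.

Lemma quo_projE v : vsval (quo v) = v - projv U v.
Proof.
rewrite comp_lfunE !lfunE /= !lfunE /= vsprojK // -lker_proj memv_ker.
by rewrite linearB /= projv_proj subrr.
Qed.

Lemma quo_eq0 v : (quo v == 0) = (v \in U).
Proof.
rewrite -(inj_eq (@subvs_inj _ _ _)) quo_projE linear0 subr_eq0.
by apply/eqP/idP=> [->|/projv_id->] //; apply: memv_proj.
Qed.

Lemma quo_inclK : cancel (incl U^C) quo.
Proof.
move=> w; apply: subvs_inj; rewrite quo_projE lfunE /=.
have /eqP-> : projv U (vsval w) == 0 by rewrite -memv_ker lker_proj subvsP.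
by rewrite subr0.
Qed.

Lemma quo_rep g v : quo (rho g (incl U^C (quo v))) = quo (rho g v).
Proof.
apply/eqP; rewrite -subr_eq0 -!linearB quo_eq0; apply: stable_mem.
by rewrite lfunE /= quo_projE addrAC subrr add0r rpredN memv_proj.
Qed.

Lemma quo_compat g h w :
  quo (rho g (incl U^C (quo (rho h (incl U^C w))))) =
  quo (rho g (rho h (incl U^C w))).
Proof. exact: quo_rep. Qed.

Definition quorep := compress_rep quo_inclK quo_compat.

Lemma quorep_eigen t a v : v \notin U -> rho t v = a *: v ->
  exists2 w, w != 0 & quorep t w = a *: w.
Proof.
move=> vU tv; exists (quo v); first by rewrite quo_eq0.
by rewrite compressE quo_rep tv linearZ.
Qed.

End Stable.

(** Induction on the dimension: an eigenvector that lies in a proper invariant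
    subspace is kept by the subrepresentation, and one that does not is kept by
    the quotient.  The last clause says that the subquotient factors through
    the image of rho, so relations among the operators of rho persist. *)
Lemma irreducible_subquotient_eigen (K : fieldType) (G : groupType)
    (V : vectType K) (rho : representation G V) (t : G) (a : K) (v : V) :
  v != 0 -> rho t v = a *: v ->
  exists (W : vectType K) (sigma : representation G W),
    [/\ irreducible_rep sigma,
        exists2 w, w != 0 & sigma t w = a *: w
      & forall g h, rho g = rho h -> sigma g = sigma h].
Proof.
have [d] := ubnP (\dim {:V}); elim: d V rho v => // d IHd V rho v ltVd v0 tv.
have [irr|nirr] := EM (irreducible_rep rho).
  by exists V, rho; split=> //; exists v.
have [U [Ust U0 UV]] : exists U : {vspace V},
    [/\ forall g, (rho g @: U <= U)%VS, U != 0%VS & U != fullv].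
  apply: contrapT => noU; apply: nirr; split.
    move=> V0; have := memvf v; rewrite V0 memv0 => v0'.
    by rewrite v0' in v0.
  move=> U Ust; apply: contrapT => /not_orP[/eqP U0 /eqP UV].
  by apply: noU; exists U.
have dU : (0 < \dim U)%N by rewrite lt0n dimv_eq0.
have ltU : (\dim U < \dim {:V})%N.
  by rewrite ltn_neqAle (dimvS (subvf U)) andbT (dimv_leqif_eq (subvf U)).
have dim_sub (W : {vspace V}) : \dim {:subvs_of W} = \dim W by rewrite dimvf.
have [vU|vU] := boolP (v \in U).
  have [w w0 tw] := subrep_eigen Ust vU v0 tv.
  have [|W [sigma [irr eig fact]]] := IHd _ (subrep Ust) w _ w0 tw.
    by rewrite dim_sub -ltnS (leq_trans _ ltVd).
  exists W, sigma; split=> // g h gh; apply: fact.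
  by apply/lfunP=> x; rewrite !compressE gh.
have [w w0 tw] := quorep_eigen Ust vU tv.
have [|W [sigma [irr eig fact]]] := IHd _ (quorep Ust) w _ w0 tw.
  rewrite dim_sub dimv_compl -ltnS (leq_trans _ ltVd) //.
  by rewrite ltnS ltn_subrL dU (leq_trans dU (dimvS (subvf U))).
exists W, sigma; split=> // g h gh; apply: fact.
by apply/lfunP=> x; rewrite !compressE gh.
Qed.

(** * Eigenvalues of an element conjugate to its power *)

Section Scaling.
Variables (K : fieldType) (G : groupType) (V : vectType K).
Variables (rho : representation G V).

Lemma rep_exp_eigen t a v k : rho t v = a *: v ->
  rho (t ^+ k)%g v = a ^+ k *: v.
Proof.
move=> tv; elim: k => [|k IHk]; first by rewrite expg0 rep1 id_lfunE scale1r.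
by rewrite expgS repM comp_lfunE IHk linearZ /= tv scalerA -exprSr.
Qed.

Lemma rep_inj g : injective (rho g).
Proof.
apply: (can_inj (g := rho g^-1%g)) => v.
by rewrite -comp_lfunE -repM mulVg rep1 id_lfunE.
Qed.

(** From t y = y t^q, the operator of y turns an eigenvector of t for b into
    one for b^q. *)
Lemma eigen_orbit t y q a i :
  rho (t * y)%g = rho (y * t ^+ q)%g ->
  (exists2 v, v != 0 & rho t v = a *: v) ->
  exists2 v, v != 0 & rho t v = a ^+ (q ^ i) *: v.
Proof.
move=> conj [v v0 tv]; elim: i => [|i [w w0 tw]].
  by exists v => //; rewrite expn0 expr1.
exists (rho y w); first by rewrite -(linear0 (rho y)) (inj_eq (@rep_inj y)).
rewrite -comp_lfunE -repM conj repM comp_lfunE (rep_exp_eigen _ tw) linearZ /=.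
by rewrite -exprM expnSr.
Qed.

End Scaling.

(** * Transvections of the path form *)

Section Transvections.
Variables (m : nat) (A : finComNzRingType).
Local Notation X := {ffun 'I_m -> A}.

(** Gram matrix of the alternating form with e_i . e_(i+1) = 1. *)
Definition path_form (i j : 'I_m) : A :=
  (j == i.+1 :> nat)%:R - (i == j.+1 :> nat)%:R.

(** A point a records the pairings of a vector v with the basis e; in these
    coordinates this is v |-> v + (v . e_i) e_i. *)
Definition transv_fun (i : 'I_m) (a : X) : X :=
  [ffun j => a j + path_form i j * a i].

Lemma path_form_id i : path_form i i = 0.
Proof. by rewrite /path_form subrr. Qed.

Lemma transv_inj i : injective (transv_fun i).
Proof.
move=> a b /ffunP ab; have abi : a i = b i.
  by have := ab i; rewrite !ffunE path_form_id !mul0r !addr0.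
by apply/ffunP=> j; have := ab j; rewrite !ffunE abi => /addIr.
Qed.

Definition transv i : {perm X} := perm (@transv_inj i).

Lemma transvE i a j : transv i a j = a j + path_form i j * a i.
Proof. by rewrite permE ffunE. Qed.

Lemma transvXE i k a j :
  (transv i ^+ k)%g a j = a j + path_form i j * a i * k%:R.
Proof.
elim: k j => [|k IHk] j; first by rewrite perm1 mulr0 addr0.
by rewrite expgSr permM transvE !IHk path_form_id; ring.
Qed.

Lemma path_formS (i j : 'I_m) : j = i.+1 :> nat ->
  path_form i j = 1 /\ path_form j i = -1.
Proof.
rewrite /path_form => ->.
by rewrite eqxx (ltn_eqF (ltnW (ltnSn i.+1))) subr0 sub0r.
Qed.

Lemma transv_far (i j : 'I_m) : (1 < `|i - j|)%N ->
  (transv i * transv j = transv j * transv i)%g.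
Proof.
move=> far; have ij : path_form i j = 0 /\ path_form j i = 0.
  rewrite /path_form; have [e|_] := eqVneq (j : nat) i.+1.
    by move: far; rewrite e distnS.
  have [e|_] := eqVneq (i : nat) j.+1; first by move: far; rewrite e distSn.
  by rewrite subrr.
apply/permP=> a; apply/ffunP=> k.
by rewrite !permM !transvE ij.1 ij.2; ring.
Qed.

Lemma transv_adj (i j : 'I_m) : j = i.+1 :> nat ->
  (transv i * (transv j * transv i) = transv j * (transv i * transv j))%g.
Proof.
move=> /path_formS[ij ji]; apply/permP=> a; apply/ffunP=> k.
by rewrite !permM !transvE !path_form_id ij ji; ring.
Qed.

(** Up to sign, x takes one basis vector, of the pair e_i, e_j, to twice the
    other, and the transvection along 2 e_i is the fourth power of the one
    along e_i. *)
Lemma transv_conj4 (i j : 'I_m) h : j = i.+1 :> nat -> h.*2%:R = 1 :> A ->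
  let x := (transv i ^+ 2 * (transv j ^+ h * transv i ^+ 2))%g in
  (transv j * x = x * transv i ^+ 4)%g.
Proof.
move=> /path_formS[ij ji] h2 x; apply/permP=> a; apply/ffunP=> k.
(* The k-th coordinates of both sides differ by (2h - 1) e. *)
pose e := 4 * path_form i k * (a i + a j) - path_form j k * a j.
rewrite /x !permM !(transvXE, transvE) !path_form_id ij ji.
apply/eqP; rewrite -subr_eq0; apply/eqP; transitivity ((h.*2%:R - 1) * e).
  by rewrite -addnn natrD /e; ring.
by rewrite h2 subrr mul0r.
Qed.

End Transvections.

(** By the braid relation, T_j T_i conjugates T_j to T_i, which turns the
    previous identity into one about T_i alone. *)
Lemma conj_pow4 (m : nat) (A : finComNzRingType) (i j : 'I_m) h :
  j = i.+1 :> nat -> h.*2%:R = 1 :> A ->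
  let y := (transv A j * (transv A i *
    (transv A i ^+ 2 * (transv A j ^+ h * transv A i ^+ 2))))%g in
  (transv A i * y = y * transv A i ^+ 4)%g.
Proof.
move=> ij h2 y; rewrite /y -!mulgA.
have := transv_conj4 ij h2; rewrite /= -!mulgA => <-.
rewrite !mulgA -(mulgA (transv A i)) -[in RHS](mulgA (transv A j)).
by rewrite transv_adj ?mulgA.
Qed.

Lemma braid_transv_rel (n : nat) (A : finComNzRingType) u v :
  @braid_rel n u v -> word_val (@transv n.-1 A) u = word_val (@transv n.-1 A) v.
Proof.
by case=> i j ij; rewrite /word_val !big_cons !big_nil /letter_val /= !mulg1;
  [apply: transv_far | apply: transv_adj].
Qed.

Lemma expr_ZpD (K : fieldType) (N : nat) (w : K) (x y : 'Z_N) :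
  (1 < N)%N -> w ^+ N = 1 -> w ^+ (x + y)%R = w ^+ x * w ^+ y.
Proof.
move=> N1 wN.
have -> : (x + y)%R = ((x + y) %% N)%N :> nat by congr modn; apply: Zp_cast.
by rewrite expr_mod // exprD.
Qed.

(** T_i adds the i-th coordinate to the j-th one and fixes the i-th, so on the
    hyperplane a_i = 1 it multiplies the character a |-> w^(a_j) by w. *)
Lemma transv_character_eigen (K : fieldType) (N m : nat) (w : K) (i j : 'I_m) :
  (1 < N)%N -> w ^+ N = 1 -> j = i.+1 :> nat ->
  exists2 f : {ffun {ffun 'I_m -> 'Z_N} -> K^o},
    f != 0 & precomp (transv _ i) f = w *: f.
Proof.
move=> N1 wN ij; have [c_ij c_ji] := path_formS ('Z_N : finComNzRingType) ij.
exists [ffun a : {ffun 'I_m -> 'Z_N} => (a i == 1)%:R * w ^+ a j].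
  (* Its value at the i-th unit vector is 1. *)
  apply/eqP=> /ffunP/(_ [ffun k => (k == i)%:R])/eqP.
  rewrite !ffunE eqxx eqxx mul1r (negPf (_ : j != i)) ?oner_eq0 //.
  apply: contraTneq isT => /(congr1 val)/=.
  by rewrite ij => /eqP; rewrite gtn_eqF.
apply/ffunP=> a; rewrite !ffunE !transvE path_form_id c_ij mul0r addr0 mul1r.
have [->|_] := eqVneq (a i) 1; last by rewrite !mul0r scaler0.
by rewrite expr_ZpD // !mul1r mulrC; congr (_ * _); rewrite /= modn_small.
Qed.

(** * Large irreducible representations of braid groups *)

Theorem theorem4p3 (R : realType) (n M : nat) (hn : (2 < n)%N) (hM : (0 < M)%N) :
  exists (V : vectType (complex R)) (rho : representation (braid_group n) V),
    irreducible_rep rho /\ (M < \dim (fullv : {vspace V}))%N.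
Proof.
(* 4 has order M + 1 modulo N, and h = (N + 1) / 2 is the inverse of 2. *)
pose N := (4 ^ M.+1 - 1)%N; pose h := (2 * 4 ^ M)%N.
have N1 : (1 < N)%N.
  by rewrite ltn_subRL (leq_trans _ (leq_pexp2l _ (_ : 1 <= M.+1)%N)).
have h2 : h.*2%:R = 1 :> 'Z_N.
  have -> : h.*2 = N.+1 by rewrite -addn1 subnK ?expn_gt0 // expnS -mul2n mulnA.
  by rewrite mulrS pchar_Zp // addr0.
have [|w prw] := @prim_root_exists (complex R) N.
  by rewrite pnatr_eq0 -lt0n ltnW.
have lt0 : (0 < n.-1)%N by case: n hn => [|[]].
have lt1 : (1 < n.-1)%N by case: n hn {lt0} => [|[|[]]].
pose i := Ordinal lt0; pose j := Ordinal lt1.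
pose psi := pres_lift (rel := @braid_rel n) (@transv n.-1 'Z_N).
pose brel := @braid_transv_rel n 'Z_N.
pose rho := perm_rep (complex R) (pres_lift1 brel) (pres_liftM brel).
pose t k : braid_group n := pres_class (@braid_rel n) [:: gen k].
pose y := (t j * (t i * (t i ^+ 2 * (t j ^+ h * t i ^+ 2))))%g.
have psiM : {morph psi : g g' / (g * g')%g} := pres_liftM brel.
have psiX g k : psi (g ^+ k)%g = (psi g ^+ k)%g.
  by elim: k => [|k IHk]; [exact: (pres_lift1 brel) | rewrite !expgS psiM IHk].
have psi_t k : psi (t k) = transv 'Z_N k by apply: (pres_lift_gen brel).
have psi_conj : psi (t i * y)%g = psi (y * t i ^+ 4)%g.
  by rewrite !(psiM, psiX) !psi_t; apply: conj_pow4.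
have [f f0 tf] := @transv_character_eigen (complex R) N n.-1 w i j N1
  (prim_expr_order prw) erefl.
have [|W [sigma [irr eig fact]]] :=
  @irreducible_subquotient_eigen _ _ _ rho (t i) w f f0.
  by rewrite lfunE /= -/(psi (t i)) psi_t.
exists W, sigma; split=> //.
pose s := [seq w ^+ (4 ^ k) | k <- iota 0 M.+1].
have -> : M.+1 = size s by rewrite size_map size_iota.
apply: (eigenvalues_le_dim (f := sigma (t i))).
  rewrite map_inj_in_uniq ?iota_uniq // => k l.
  have ltN p : p \in iota 0 M.+1 -> (4 ^ p < N)%N.
    rewrite mem_iota add0n /= ltnS => lepM.
    rewrite ltn_subRL add1n (leq_ltn_trans (_ : _ <= 2 * 4 ^ M)%N) //.
      by rewrite (leq_ltn_trans (leq_pexp2l _ lepM)) // ltn_Pmull ?expn_gt0.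
    by rewrite expnS ltn_pmul2r ?expn_gt0.
  move=> /ltN kN /ltN lN /eqP; rewrite (eq_prim_root_expr prw) !modn_small //.
  by move/eqP/expnI; apply.
move=> _ /mapP[k _ ->]; apply: eigen_orbit eig => //.
apply: fact.
exact: (congr1 (fun g => linfun (@precomp (complex R) _ g)) psi_conj).
Qed.
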